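(* (1) For each of the architectures $(1,1)$, $(1,1,1)$ and $(1,1,1,1)$, the upper bound $\dim_{\mathrm{fun}}(\mathcal{P}_{n_0,\ldots,n_m})\le n_m+\sum_{i=0}^{m-1}n_in_{i+1}$ is tight, i.e. equality holds. (2) Let $(1,\ldots,1)$ be any sequence of at least $5$ consecutive $1$s. Then the upper bound $\dim_{\mathrm{fun}}(\mathcal{P}_{n_0,\ldots,n_m})\le n_m+\sum_{i=0}^{m-1}n_in_{i+1}$ is not tight for the architecture $(1,\ldots,1)$. Specifically, $$\dim_{\mathrm{fun}}(\mathcal{P}_{1,\ldots,1})=4.$$
   Context: An architecture is a tuple $(n_0,\ldots,n_m)$ of positive integers with $m\ge 1$. Let $\sigma$ denote the map applying $t\mapsto\max\{0,t\}$ to each coordinate of a vector in any $\mathbb{R}^n$. Put $D(n_0,\ldots,n_m)=\sum_{i=1}^m n_i(n_{i-1}+1)$ and $\mathcal{P}_{n_0,\ldots,n_m}=\mathbb{R}^{D(n_0,\ldots,n_m)}$ (parameter space). A parameter $\theta\in\mathcal{P}_{n_0,\ldots,n_m}$ is identified with a list of matrices $[A^i]$ of size $n_i\times(n_{i-1}+1)$, $1\le i\le m$, giving affine maps $A^i:\mathbb{R}^{n_{i-1}}\to\mathbb{R}^{n_i}$, $A^i(x)=[A^i][x,1]^T$. The realization map $\rho$ sends $\theta$ to the function $\rho(\theta)=\sigma\circ A^m\circ\cdots\circ\sigma\circ A^1:\mathbb{R}^{n_0}\to\mathbb{R}^{n_m}$. Let $\mathcal{F}(\theta,x)=\rho(\theta)(x)$.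 A point $x\in\mathbb{R}^{n_0}$ is parametrically smooth for $\theta$ if $\mathcal{F}:\mathcal{P}_{n_0,\ldots,n_m}\times\mathbb{R}^{n_0}\to\mathbb{R}^{n_m}$ is $C^\infty$ at $(\theta,x)$ (i.e. on a neighborhood of it). A finite set $Z\subset\mathbb{R}^{n_0}$ is parametrically smooth for $\theta$ if all its points are. A parameter $\theta$ is ordinary if at least one point of $\mathbb{R}^{n_0}$ is parametrically smooth for $\theta$. For a finite ordered set $Z=\{z_1,\ldots,z_k\}\subset\mathbb{R}^{n_0}$, the evaluation map $E_Z:\mathcal{P}_{n_0,\ldots,n_m}\to\mathbb{R}^{k n_m}$ is $E_Z(\theta)=(\rho(\theta)(z_1),\ldots,\rho(\theta)(z_k))$, and $\mathbf{J}E_Z|_\theta$ is its Jacobian matrix with respect to the parameter coordinates at $\theta$. The functional dimension of an ordinary parameter $\theta$ is $$\dim_{\mathrm{fun}}(\theta)=\sup\{\operatorname{rank}\mathbf{J}E_Z|_\theta : Z\subset\mathbb{R}^{n_0}\text{ finite and parametrically smooth for }\theta\},$$ and the functional dimension of parameter space is $\dim_{\mathrm{fun}}(\mathcal{P}_{n_0,\ldots,n_m})=\sup\{\dim_{\mathrm{fun}}(\theta):\theta\in\mathcal{P}_{n_0,\ldots,n_m}\text{ ordinary}\}$. The displayed upper bound on $\dim_{\mathrm{fun}}(\mathcal{P}_{n_0,\ldots,n_m})$ holds for every architecture (proved earlier in the paper). *)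

(* Defs.v *)
From HB Require Import structures.
From mathcomp Require Import all_boot all_order all_algebra.
From mathcomp Require Import all_classical all_reals all_analysis.
Set Implicit Arguments.
Unset Strict Implicit.
Unset Printing Implicit Defensive.
Import Order.TTheory GRing.Theory Num.Theory.
Import numFieldNormedType.Exports.
Local Open Scope classical_set_scope.
Local Open Scope ring_scope.

(* An architecture (n_0, ..., n_m) is a depth m together with a width function
   n : nat -> nat, of which only the values n 0, ..., n m are used.
   Positivity of m and of the n_i plays no role in the definitions. *)

Definition layer_size (n : nat -> nat) (i : nat) : nat := (n i.+1 * (n i + 1))%N.

(* D(n_0, ..., n_m); layer i : 'I_m here is the paper's layer i + 1. *)
Definition param_dim (m : nat) (n : nat -> nat) : nat :=
  (\sum_(i < m) layer_size n i)%N.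

Section Networks.
Variables (R : realType) (m : nat) (n : nat -> nat).

Definition params := 'rV[R]_(param_dim m n).

(* The coordinates of theta are grouped by layer, and within a layer the
   entries of the matrix are listed row by row. *)
Definition weight (theta : params) (i : 'I_m) : 'M[R]_(n i.+1, n i + 1) :=
  vec_mx (submxrow (q_ := fun i : 'I_m => layer_size n i) theta i).

Definition relu (d : nat) (x : 'cV[R]_d) : 'cV[R]_d := map_mx (Num.max 0) x.

Definition affine (d e : nat) (A : 'M[R]_(e, d + 1)) (x : 'cV[R]_d) : 'cV[R]_e :=
  A *m col_mx x (const_mx 1 : 'cV[R]_1).

(* Composition of the first k layers; [lt_k : k' < m] is by definition
   [k'.+1 <= m]. *)
Fixpoint layers (theta : params) (k : nat) :
    (k <= m)%N -> 'cV[R]_(n 0) -> 'cV[R]_(n k) :=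
  match k with
  | 0 => fun _ x => x
  | k'.+1 => fun lt_k x =>
      relu (affine (weight theta (Ordinal lt_k)) (layers theta (ltnW lt_k) x))
  end.

Definition realization (theta : params) : 'cV[R]_(n 0) -> 'cV[R]_(n m) :=
  layers theta (leqnn m).

Definition evalF (p : params * 'cV[R]_(n 0)) : 'cV[R]_(n m) :=
  realization p.1 p.2.

End Networks.

(* f is C^k on the set U, meant for U open and V finite dimensional: f is
   differentiable on U and its directional derivatives (equivalently, its
   partial derivatives) are C^(k-1) on U; C^0 means continuous. *)
Fixpoint Ck_on (R : realType) (V W : normedModType R) (k : nat) (U : set V)
    (f : V -> W) : Prop :=
  match k with
  | 0 => forall x, U x -> {for x, continuous f}
  | k'.+1 => (forall x, U x -> differentiable f x) /\
             (forall v : V, Ck_on k' U ('D_v f))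
  end.

Definition smooth_at (R : realType) (V W : normedModType R)
    (f : V -> W) (p : V) : Prop :=
  exists U : set V, [/\ open U, U p & forall k, Ck_on k U f].

Section FunctionalDimension.
Variables (R : realType) (m : nat) (n : nat -> nat).
Local Notation P := (params R m n).
Local Notation X := 'cV[R]_(n 0).

Definition param_smooth (theta : P) (x : X) : Prop :=
  smooth_at (@evalF R m n) (theta, x).

Definition param_smooth_seq (theta : P) (Z : seq X) : Prop :=
  forall x, x \in Z -> param_smooth theta x.

Definition ordinary (theta : P) : Prop := exists x, param_smooth theta x.

(* [mxvec] concatenates the rows, so E_Z(theta) is
   (rho(theta)(z_1), ..., rho(theta)(z_k)). *)
Definition eval_map (Z : seq X) (theta : P) : 'rV[R]_(size Z * n m) :=
  mxvec (\matrix_(i < size Z, j < n m) realization theta Z`_i j 0).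

(* Finite ordered sets are duplicate-free sequences.  The library's ['J f p]
   acts on row vectors; its transpose is the usual Jacobian matrix.  The
   suprema are taken in the extended reals. *)
Definition dim_fun (theta : P) : \bar R :=
  ereal_sup [set (\rank (('J (eval_map Z) theta)^T))%:R%:E
            | Z in [set Z : seq X | uniq Z /\ param_smooth_seq theta Z]].

Definition dim_fun_params : \bar R :=
  ereal_sup [set dim_fun theta | theta in [set theta : P | ordinary theta]].

End FunctionalDimension.

Definition dim_fun_bound (m : nat) (n : nat -> nat) : nat :=
  (n m + \sum_(i < m) n i * n i.+1)%N.

Definition tight (R : realType) (m : nat) (n : nat -> nat) : Prop :=
  dim_fun_params R m n = (dim_fun_bound m n)%:R%:E.

(* With depth m, this is the architecture made of m + 1 ones. *)
Definition ones : nat -> nat := fun=> 1%N.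

(* Main.v *)
Require Import Defs.
From HB Require Import structures.
From mathcomp Require Import all_boot all_order all_algebra.
From mathcomp Require Import all_classical all_reals all_analysis.
From mathcomp Require Import ring lra zify.
Import Order.TTheory GRing.Theory Num.Theory.
Import numFieldNormedType.Exports.
Local Open Scope classical_set_scope.
Local Open Scope ring_scope.
Set Implicit Arguments. Unset Strict Implicit.

(* For an architecture of m + 1 ones the functional dimension is min (m + 1, 4).

   Upper bound.  Perturbing the biases makes all preactivations at the points
   of Z nonzero; since the Jacobian is continuous and the rank is lower
   semicontinuous, it suffices to bound the rank there.  Then a point z whose
   neurons are all active contributes the gradient of theta |-> c z + d, so all
   such points together contribute rank at most 2.  A point whose last
   inactive layer is j contributes the gradient of the value that layers
   j + 1, ..., m take at 0, which depends on j only and vanishes for j = m.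
   Hence the rank is at most 2 + (m - 1).  Moreover every layer is a monotone
   function of one variable and therefore preserves betweenness, which forbids
   three different values of j for the same parameter; hence the rank is at
   most 2 + 2.

   Lower bound.  The network x |-> max 0 x, h |-> max 0 (3 - h),
   h |-> max 0 (h + 1), followed by identities, has two non-constant points
   and two plateaus, and a triangular matrix of directional derivatives. *)


(** * Networks of width one *)

Section Scalar.
Variable R : realType.
Implicit Types (a b : nat -> R) (pat : nat -> bool) (x y w : R).

Fixpoint net a b x k : R :=
  if k is k'.+1 then Num.max 0 (a k' * net a b x k' + b k') else x.

Definition preact a b x k := a k * net a b x k + b k.

(* What [net] becomes on the region where layer k is active iff [pat k]; unlike
   [net] it is polynomial in all its arguments. *)
Fixpoint lin pat a b x k : R :=
  if k is k'.+1 then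
    if pat k' then a k' * lin pat a b x k' + b k' else 0
  else x.

(** The derivative of [lin] in the parameters along the direction [da], [db]; the input is held
    fixed, hence the initial value 0. *)
Fixpoint lin_tangent pat a b da db x k : R :=
  if k is k'.+1 then
    if pat k' then
      da k' * lin pat a b x k' + a k' * lin_tangent pat a b da db x k' + db k'
    else 0
  else 0.

Lemma net_ge0 a b x k : 0 <= net a b x k.+1.
Proof. by rewrite /= le_max lexx. Qed.

Lemma lin_affine pat a b x k :
  lin pat a b x k = lin pat a b 0 k + x * (lin pat a b 1 k - lin pat a b 0 k).
Proof.
elim: k => [|k IH] /=; first by rewrite add0r subr0 mulr1.
rewrite IH; case: ifP => _; last by rewrite subrr mulr0 addr0.
by move: (lin _ _ _ 0 _) (lin _ _ _ 1 _) => s t; ring.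
Qed.

(** For one fixed pattern the tangent is affine in the input, so the gradients at all points sharing
    the pattern lie in the span of those at 0 and 1. *)
Lemma lin_tangent_affine pat a b da db x k :
  lin_tangent pat a b da db x k =
  lin_tangent pat a b da db 0 k +
  x * (lin_tangent pat a b da db 1 k - lin_tangent pat a b da db 0 k).
Proof.
elim: k => [|k IH] /=; first by rewrite subrr mulr0 addr0.
rewrite IH (lin_affine _ _ _ x); case: ifP => _; last by rewrite subrr mulr0 addr0.
move: (lin _ _ _ 0 _) (lin _ _ _ 1 _) => s t.
by move: (lin_tangent _ _ _ _ _ 0 _) (lin_tangent _ _ _ _ _ 1 _) => u v; ring.
Qed.

(** A dead layer [j] outputs 0 and so forgets the input and the earlier pattern. The canonical
    pattern [fun i => j < i] then leaves a single gradient per [j]. *)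
Lemma lin_last_dead pat a b x y j k : (j < k)%N -> ~~ pat j ->
    (forall i, (j < i < k)%N -> pat i) ->
  lin pat a b x k = lin (fun i => j < i)%N a b y k.
Proof.
move=> jk pj; elim: k jk => // k IH; rewrite ltnS leq_eqVlt => /predU1P[<- _|jk pt] /=.
  by rewrite (negbTE pj) ltnn.
rewrite jk pt ?jk ?ltnSn// IH// => i /andP[ji ik].
by rewrite pt// ji ltnS ltnW.
Qed.

Lemma lin_tangent_last_dead pat a b da db x y j k : (j < k)%N -> ~~ pat j ->
    (forall i, (j < i < k)%N -> pat i) ->
  lin_tangent pat a b da db x k = lin_tangent (fun i => j < i)%N a b da db y k.
Proof.
move=> jk pj; elim: k jk => // k IH; rewrite ltnS leq_eqVlt => /predU1P[<- _|jk pt] /=.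
  by rewrite (negbTE pj) ltnn.
have pt' i : (j < i < k)%N -> pat i by case/andP=> ji ik; rewrite pt// ji ltnS ltnW.
by rewrite jk pt ?jk ?ltnSn// IH// (@lin_last_dead _ _ _ _ y j).
Qed.

Lemma eq_lin_tangent pat pat' a b da db x k : (forall i, (i < k)%N -> pat i = pat' i) ->
  lin_tangent pat a b da db x k = lin_tangent pat' a b da db x k.
Proof.
have linE k' : (forall i, (i < k')%N -> pat i = pat' i) -> lin pat a b x k' = lin pat' a b x k'.
  elim: k' => //= k' IH e; rewrite e// IH// => i ik; exact/e/ltnW.
elim: k => //= k IH e; have e' i : (i < k)%N -> pat i = pat' i by move=> ik; exact/e/ltnW.
by rewrite e// IH// linE.
Qed.

Lemma last_deadP pat k : (forall i, (i < k)%N -> pat i) \/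
  exists2 j, (j < k)%N & ~~ pat j /\ forall i, (j < i < k)%N -> pat i.
Proof.
elim: k => [|k [pt|[j jk [pj pt]]]]; first by left.
- case: (boolP (pat k)) => pk; [left|right].
    by move=> i; rewrite ltnS leq_eqVlt => /predU1P[->//|/pt].
  by exists k => //; split=> // i /andP[ki]; rewrite ltnS leqNgt ki.
- case: (boolP (pat k)) => pk; right; last first.
    by exists k => //; split=> // i /andP[ki]; rewrite ltnS leqNgt ki.
  exists j; first exact: ltnW.
  split=> // i /andP[ji]; rewrite ltnS leq_eqVlt => /predU1P[->//|ik].
  by apply: pt; rewrite ji.
Qed.

Definition between x y w := (x <= y <= w) || (w <= y <= x).

(** A layer is monotone, increasing or decreasing by the sign of its slope; as [between] is
    symmetric in its outer arguments, both cases preserve it. *)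
Lemma between_net a b x y w p q : (p <= q)%N ->
  between (net a b x p) (net a b y p) (net a b w p) ->
  between (net a b x q) (net a b y q) (net a b w q).
Proof.
move=> /subnK <-; elim: (q - p)%N => // k IH /IH; rewrite addSn /=.
move: (net _ _ x _) (net _ _ y _) (net _ _ w _) => {IH}x {}y {}w.
have up c s t : 0 <= c -> s <= t ->
    Num.max 0 (c * s + b (k + p)%N) <= Num.max 0 (c * t + b (k + p)%N).
  by move=> c0 st; rewrite ge_max le_max lexx /= le_max lerD2r ler_wpM2l// orbT.
have dn c s t : c <= 0 -> s <= t ->
    Num.max 0 (c * t + b (k + p)%N) <= Num.max 0 (c * s + b (k + p)%N).
  by move=> c0 st; rewrite ge_max le_max lexx /= le_max lerD2r ler_wnM2l// orbT.
rewrite /between; have [a0|/ltW a0] := leP 0 (a (k + p)%N).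
  by case/orP => /andP[h1 h2]; apply/orP; [left|right]; rewrite !up.
by case/orP => /andP[h1 h2]; apply/orP; [right|left]; rewrite !dn.
Qed.

(** After layer [l] the point [w] sits at the minimum 0, so one of [x], [y] lies between [w] and the
    other. If it is [x], then after layer [j] the value 0 of [x] would lie between two positive
    values. If it is [y], then [x] is also 0 after layer [k], so [x] and [y] agree from there on,
    although layer [j] separates them. *)
Lemma no_three_plateaus a b m x y w j k l : (l < k < j)%N -> (j < m)%N ->
  net a b x j.+1 = 0 -> net a b y k.+1 = 0 -> net a b w l.+1 = 0 ->
  (forall i, (k < i < m)%N -> 0 < net a b y i.+1) ->
  (forall i, (l < i < m)%N -> 0 < net a b w i.+1) -> False.
Proof.
move=> /andP[lk kj] jm xj yk wl yp wp.
have yj : 0 < net a b y j.+1 by apply: yp; rewrite kj jm.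
have wj : 0 < net a b w j.+1 by apply: wp; rewrite (ltn_trans lk)// jm.
have wk : 0 < net a b w k.+1 by apply: wp; rewrite lk (ltn_trans kj).
case: (leP (net a b x l.+1) (net a b y l.+1)) => [xy|/ltW yx].
  have : between (net a b w l.+1) (net a b x l.+1) (net a b y l.+1).
    by rewrite /between wl net_ge0 xy.
  move=> /(@between_net _ _ _ _ _ _ j.+1)-/(_ (ltnW (ltn_trans lk kj))).
  by rewrite /between xj !leNgt wj yj.
have : between (net a b w l.+1) (net a b y l.+1) (net a b x l.+1).
  by rewrite /between wl net_ge0 yx.
move=> /(@between_net _ _ _ _ _ _ k.+1)-/(_ (ltnW lk)).
rewrite /between yk [net _ _ w _ <= 0]leNgt wk andFb orFb => /andP[xk _].
(* Equality of the two values is propagated as betweenness with equal ends. *)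
have : between (net a b y k.+1) (net a b x k.+1) (net a b y k.+1).
  by rewrite /between yk xk net_ge0.
move=> /(@between_net _ _ _ _ _ _ j.+1)-/(_ (ltnW kj)).
by rewrite /between xj leNgt yj.
Qed.

End Scalar.


(** * Rank, smoothness and differentiation *)

Section RankSemicontinuity.
Variables (R : realType).

Lemma continuous_det (T : topologicalType) n (M : T -> 'M[R]_n) (t : T) :
  (forall i j, {for t, continuous (fun t' => M t' i j)}) ->
  {for t, continuous (fun t' => \det (M t'))}.
Proof.
move=> Mc; rewrite /continuous_at /determinant.
apply: cvg_big => [|s _]; first exact: add_continuous.
apply: cvgM; first exact: cvg_cst.
by apply: cvg_big => [|i _]; [exact: mul_continuous|exact: Mc].
Qed.

Lemma continuous_mulmx (T : topologicalType) p q r (M : T -> 'M[R]_(p, q))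
    (N : T -> 'M[R]_(q, r)) (t : T) :
  (forall i j, {for t, continuous (fun t' => M t' i j)}) ->
  (forall i j, {for t, continuous (fun t' => N t' i j)}) ->
  forall i j, {for t, continuous (fun t' => (M t' *m N t') i j)}.
Proof.
move=> Mc Nc i j.
have -> : (fun t' => (M t' *m N t') i j) = (fun t' => \sum_k M t' i k * N t' k j).
  by apply/funext => t'; rewrite mxE.
apply: cvg_big => [|k _]; first exact: add_continuous.
by apply: cvgM; [exact: Mc|exact: Nc].
Qed.

(** Fixed factors [L] and [N] reduce [M t] to an identity matrix of size its rank; the determinant
    of [L *m M t' *m N] is continuous at [t] and equals 1 there, so it stays nonzero nearby. *)
Lemma mxrank_lower_semicontinuous (T : topologicalType) p q
    (M : T -> 'M[R]_(p, q)) (t : T) :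
  (forall i j, {for t, continuous (fun t' => M t' i j)}) ->
  \forall t' \near t, (\rank (M t) <= \rank (M t'))%N.
Proof.
move=> Mc; set r := \rank (M t).
pose L : 'M[R]_(r, p) := pid_mx r *m invmx (col_ebase (M t)).
pose N : 'M[R]_(q, r) := invmx (row_ebase (M t)) *m pid_mx r.
have LMN : L *m M t *m N = 1%:M.
  rewrite -[M t in LHS]mulmx_ebase /L /N !mulmxA.
  rewrite mulmxKV ?col_ebase_unit// -mulmxA mulmxA.
  rewrite -(mulmxA _ (row_ebase _)) mulmxV ?row_ebase_unit// mulmx1.
  by rewrite !pid_mx_id ?pid_mx_1 ?rank_leq_row ?rank_leq_col.
have dc : {for t, continuous (fun t' => \det (L *m M t' *m N))}.
  apply: continuous_det; apply: continuous_mulmx => [|i j]; last exact: cvg_cst.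
  by apply: continuous_mulmx => // i j; exact: cvg_cst.
have : \forall t' \near t, \det (L *m M t' *m N) != 0.
  apply: (dc [set x | x != 0]); apply: open_nbhs_nbhs; split.
    exact: open_neq.
  by rewrite /= LMN det1 oner_neq0.
apply: filterS => t' d0.
have /mxrank_unit <- : L *m M t' *m N \in unitmx by rewrite unitmxE unitfE.
exact: leq_trans (mxrankM_maxl _ _) (mxrankM_maxr _ _).
Qed.

End RankSemicontinuity.

Section PolynomialFun.
Variables (R : realType) (V : normedModType R).

(** The class is closed under directional derivatives, which makes C^k for every k a plain
    induction. *)
Inductive polynomial_fun : (V -> R) -> Prop :=
| Poly_linear (f : {linear V -> R}) : continuous f -> polynomial_fun f
| Poly_cst c : polynomial_fun (cst c)
| Poly_add f g : polynomial_fun f -> polynomial_fun g -> polynomial_fun (f + g)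
| Poly_mul f g : polynomial_fun f -> polynomial_fun g -> polynomial_fun (f * g).

Lemma polynomial_differentiable f : polynomial_fun f ->
  forall x, differentiable f x.
Proof.
elim=> {f} [f fc x|c x|f g _ df _ dg x|f g _ df _ dg x].
- exact: linear_differentiable.
- exact: differentiable_cst.
- exact: differentiableD.
- exact: differentiableM.
Qed.

Lemma polynomial_derive f v : polynomial_fun f -> polynomial_fun ('D_v f).
Proof.
elim=> {f} [f fc|c|f g pf dpf pg dpg|f g pf dpf pg dpg].
- have -> : 'D_v f = cst (f v); last exact: Poly_cst.
  by apply/funext => x; rewrite deriveE ?diff_lin//; exact: linear_differentiable.
- have -> : 'D_v (cst c) = cst 0 :> (V -> R); last exact: Poly_cst.
  by apply/funext => x; rewrite derive_cst.
- have -> : 'D_v (f + g) = 'D_v f + 'D_v g; last exact: Poly_add.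
  apply/funext => x.
  by rewrite deriveD//; apply/diff_derivable/polynomial_differentiable.
- have -> : 'D_v (f * g) = f * 'D_v g + g * 'D_v f.
    apply/funext => x.
    by rewrite deriveM//; apply/diff_derivable/polynomial_differentiable.
  by apply: Poly_add; apply: Poly_mul.
Qed.

Lemma polynomial_Ck (W : normedModType R) (w : W) f k U : polynomial_fun f ->
  Ck_on k U (fun x => f x *: w).
Proof.
have d g x : polynomial_fun g -> differentiable (fun x => g x *: w) x.
  by move=> pg; apply/differentiableZl/polynomial_differentiable.
elim: k f => [|k IH] f pf /=.
  by move=> x _; apply: differentiable_continuous; exact: d.
split=> [x _|v]; first exact: d.
have -> : 'D_v (fun x => f x *: w) = (fun x => 'D_v f x *: w).
  apply/funext => x; have df := polynomial_differentiable pf x.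
  by rewrite deriveE ?diffZl ?deriveE//; exact: d.
exact/IH/polynomial_derive.
Qed.

End PolynomialFun.

Section Locality.
Variables (R : realType) (V W : normedModType R).

Lemma near_eq_differentiable (f g : V -> W) (x : V) :
  (\near x, f x = g x) -> differentiable f x -> differentiable g x.
Proof.
move=> fg /diff_locallyP[dc fE].
(* The remainder of [g] at [x] agrees near 0 with that of [f], so the differential of [f] also
   serves for [g]. *)
have gE : g \o shift x = cst (g x) + 'd f x +o_ (0 : V) id.
  apply/eqaddoP => _/posnumP[e].
  have /eqaddoP /(_ _ [gt0 of e%:num]) fe := fE.
  have fg0 : \forall h \near (0 : V), f (h + x) = g (h + x).
    by move: fg; rewrite (near_shift 0 x) subr0.
  near=> h; have -> : (g \o shift x - (cst (g x) + 'd f x)) h =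
      (f \o shift x - (cst (f x) + 'd f x)) h.
    rewrite /= !fctE /= (nbhs_singleton fg); congr (_ - _).
    by apply/esym; near: h.
  by near: h.
apply/diff_locallyP; suff -> : 'd g x = 'd f x :> (V -> W) by [].
exact: diff_unique.
Unshelve. all: by end_near. Qed.

Lemma eq_Ck_on k (U : set V) (f g : V -> W) :
  open U -> (forall x, U x -> f x = g x) -> Ck_on k U f -> Ck_on k U g.
Proof.
move=> oU; elim: k f g => [|k IH] f g fg /=.
  move=> cf x Ux; change (g @ x --> g x); rewrite -(fg _ Ux).
  apply: cvg_trans (cf x Ux); apply: near_eq_cvg.
  by apply: filterS (open_nbhs_nbhs (conj oU Ux)) => y /fg.
have nfg x : U x -> \near x, f x = g x.
  by move=> Ux; apply: filterS (open_nbhs_nbhs (conj oU Ux)) => y /fg.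
move=> [df Df]; split=> [x Ux|v]; last first.
  by apply: IH (Df v) => x Ux; exact/near_eq_derive/nfg.
by apply: near_eq_differentiable (df x Ux); exact: nfg.
Qed.

End Locality.


(** * The realization map near a regular point *)

Section Ones.
Variables (R : realType) (m : nat).
Local Notation P := (params R m ones).
Local Notation X := 'cV[R]_1.
Implicit Types (theta v : P) (z : X).

(** Extended by 0 past the last layer, so that slopes and biases are sequences on [nat], as [net]
    expects. *)
Definition coef (c : 'I_(1 + 1)) theta (k : nat) : R :=
  oapp (fun i : 'I_m => (weight theta i : 'M[R]_(1, 1 + 1)) 0 c) 0 (insub k).
Definition slope := coef (lshift 1 0).
Definition bias := coef (rshift 1 0).

Lemma coefP c k : (exists q, forall theta, coef c theta k = theta 0 q) \/
  (forall theta, coef c theta k = 0).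
Proof.
rewrite /coef; case: insubP => [i _ _|_]; [left|by right].
by eexists => theta /=; rewrite /weight !mxE.
Qed.

Lemma coef_continuous c k : continuous (fun theta => coef c theta k).
Proof.
case: (coefP c k) => [[q E]|E]; rewrite (funext E); last exact: cst_continuous.
exact: coord_continuous.
Qed.

Lemma coef_lin c k s theta v : coef c (s *: theta + v) k = s * coef c theta k + coef c v k.
Proof.
by case: (coefP c k) => [[q E]|E]; rewrite !E ?mxE// mulr0 addr0.
Qed.

Lemma is_derive_coef c k theta v :
  is_derive theta v (fun theta' => coef c theta' k) (coef c v k).
Proof.
pose f : P -> R := fun theta' => coef c theta' k.
have fl : linear f by move=> s u w; exact: coef_lin.
pose fL : {linear P -> R} := HB.pack f (GRing.isLinear.Build _ _ _ _ f fl).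
have fd : differentiable fL theta by apply/linear_differentiable/coef_continuous.
apply: DeriveDef; first exact: (diff_derivable fd).
rewrite -[LHS]/('D_v fL theta) deriveE// diff_lin//.
exact: coef_continuous.
Qed.

Definition param_of (a b : nat -> R) : P :=
  \mxrow_(i < m) (mxvec (\matrix_(r < 1, c < 1 + 1)
    if c == lshift 1 0 then a i else b i) : 'rV[R]_(layer_size ones i)).

Lemma coef_param_of c a b k : coef c (param_of a b) k =
  if (k < m)%N then if c == lshift 1 0 then a k else b k else 0.
Proof.
rewrite /coef; case: insubP => [i _ <-|/negbTE->//]; rewrite ltn_ord /=.
by rewrite /weight /param_of mxrowK mxvecK mxE.
Qed.

Lemma layersE theta k (lek : (k <= m)%N) z i j :
  layers (n := ones) theta lek z i j = net (slope theta) (bias theta) (z 0 0) k.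
Proof.
elim: k lek i j => [|k IH] lek i j /=; first by rewrite !ord1.
rewrite /relu /affine mxE mxE; congr Num.max.
rewrite (@big_split_ord _ _ _ 1 1) /= !big_ord1 col_mxEu col_mxEd !mxE IH mulr1.
by rewrite /slope /bias /coef (insubT (fun i => i < m)%N lek) /= /weight !mxE !ord1.
Qed.

Lemma realizationE theta z i j :
  realization (n := ones) theta z i j = net (slope theta) (bias theta) (z 0 0) m.
Proof. exact: layersE. Qed.

Lemma coef_polynomial c k : polynomial_fun (fun p : P * X => coef c p.1 k).
Proof.
pose f (p : P * X) : R := coef c p.1 k.
have fl : linear f by move=> s u w; exact: coef_lin.
pose fL : {linear (P * X)%type -> R} := HB.pack f (GRing.isLinear.Build _ _ _ _ f fl).
apply: (@Poly_linear _ _ fL) => p.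
by apply: (@continuous_comp _ _ _ fst (fun t => coef c t k));
  [exact: (@cvg_fst _ _ (nbhs p.1) (nbhs p.2))|exact: coef_continuous].
Qed.

Lemma input_polynomial : polynomial_fun (fun p : P * X => p.2 0 0).
Proof.
pose f (p : P * X) : R := p.2 0 0.
have fl : linear f by move=> s u w; rewrite /f /= !mxE.
pose fL : {linear (P * X)%type -> R} := HB.pack f (GRing.isLinear.Build _ _ _ _ f fl).
apply: (@Poly_linear _ _ fL) => p.
by apply: (@continuous_comp _ _ _ snd (fun z : X => z 0 0));
  [exact: (@cvg_snd _ _ (nbhs p.1) (nbhs p.2))|exact: coord_continuous].
Qed.

Definition lin_at pat k (p : P * X) : R := lin pat (slope p.1) (bias p.1) (p.2 0 0) k.

Lemma lin_polynomial pat k : polynomial_fun (lin_at pat k).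
Proof.
rewrite /lin_at; elim: k => [|k IH] /=; first exact: input_polynomial.
case: (pat k); last exact: Poly_cst.
apply: Poly_add (coef_polynomial _ _).
exact: Poly_mul (coef_polynomial _ _) IH.
Qed.

Definition preact_at k (p : P * X) : R := preact (slope p.1) (bias p.1) (p.2 0 0) k.
Definition pat_at p k := 0 < preact_at k p.
Definition regular (p : P * X) := forall k, (k < m)%N -> preact_at k p != 0.

Definition net_at k (p : P * X) := net (slope p.1) (bias p.1) (p.2 0 0) k.

(** By induction the preactivation of each layer agrees near [p] with a polynomial function [g],
    whose sign at [p] persists nearby; this freezes the activation pattern. *)
Lemma near_net_lin k p : (forall i, (i < k)%N -> preact_at i p != 0) ->
  \forall q \near p, net_at k q = lin_at (pat_at p) k q.
Proof.
elim: k => [|k IH] nz; first exact: (@filterE _ (nbhs p)) (fun q => erefl).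
have nE := IH (fun i ik => nz i (ltnW ik)).
pose g q := slope q.1 k * lin_at (pat_at p) k q + bias q.1 k.
have gc : {for p, continuous g}.
  apply/differentiable_continuous/polynomial_differentiable.
  apply: Poly_add (coef_polynomial _ _).
  exact: Poly_mul (coef_polynomial _ _) (lin_polynomial _ _).
have gp : g p = preact_at k p by rewrite /g /preact_at /preact -/(net_at k p) (nbhs_singleton nE).
have := nz k (ltnSn k); rewrite neq_lt => /orP[pk|pk].
- have : \forall q \near p, g q < 0.
    by apply: (gc [set t | t < 0]); apply: open_nbhs_nbhs; split; [exact: open_lt|rewrite /= gp].
  move: nE; apply: filterS2 => q nEq gq.
  rewrite /lin_at /net_at /= /pat_at ltNge (ltW pk) /= -/(net_at k q) nEq.
  by apply/max_idPl; exact: ltW.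
- have : \forall q \near p, 0 < g q.
    by apply: (gc [set t | 0 < t]); apply: open_nbhs_nbhs; split; [exact: open_gt|rewrite /= gp].
  move: nE; apply: filterS2 => q nEq gq.
  rewrite /lin_at /net_at /= {1}/pat_at pk /= -/(net_at k q) nEq.
  by apply/max_idPr; exact: ltW.
Qed.

Lemma regular_smooth theta z : regular (theta, z) ->
  param_smooth (n := ones) theta z.
Proof.
move=> reg; pose g q := lin_at (pat_at (theta, z)) m q *: (const_mx 1 : 'cV[R]_1).
(* The interior of the coincidence set is open by construction, and [near_net_lin] puts the point in
   it. *)
exists [set q | evalF (n := ones) q = g q]°; split; first exact: open_interior.
- apply: filterS (near_net_lin reg) => q nq.
  apply/matrixP => i j; rewrite /evalF realizationE.
  by rewrite [in RHS]mxE mxE mulr1.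
- move=> k; apply: (@eq_Ck_on _ _ _ _ _ g); first exact: open_interior.
    by move=> q /interior_subset.
  by apply: polynomial_Ck; exact: lin_polynomial.
Qed.

Lemma is_derive_lin pat k x theta v :
  is_derive theta v (fun theta' => lin pat (slope theta') (bias theta') x k)
    (lin_tangent pat (slope theta) (bias theta) (slope v) (bias v) x k).
Proof.
elim: k => [|k IH] /=; first exact: is_derive_cst.
case: (pat k); last exact: is_derive_cst.
have D := is_deriveD (is_deriveM (is_derive_coef (lshift 1 0) k theta v) IH)
  (is_derive_coef (rshift 1 0) k theta v).
apply: (@is_derive_eq _ _ _ _ _ _ _ _ D); congr (_ + _).
by rewrite addrC mulrC.
Qed.

Lemma near_fst theta z (Q : P * X -> Prop) :
  (\forall q \near (theta, z), Q q) -> \forall theta' \near theta, Q (theta', z).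
Proof.
move=> [[A B] [/= nA nB] AB]; apply: filterS nA => theta' At.
by apply: AB; split=> //=; exact: nbhs_singleton.
Qed.

Lemma derive_realization theta z i j v : regular (theta, z) ->
  'D_v (fun theta' => realization (n := ones) theta' z i j) theta =
  lin_tangent (pat_at (theta, z)) (slope theta) (bias theta) (slope v) (bias v) (z 0 0) m.
Proof.
move=> reg; rewrite -(derive_val (is_derive := is_derive_lin _ _ _ _ _)).
apply: near_eq_derive; apply: filterS (near_fst (near_net_lin reg)) => q.
by rewrite realizationE.
Qed.

End Ones.


(** Parametric smoothness concerns parameter and input jointly, the Jacobian only the parameter;
    directions [(v, 0)] link the two. *)
Lemma derive_fst (R : realType) (U V W : normedModType R) (f : U * V -> W)
    (x : U) (y : V) (v : U) :
  'D_(v, 0) f (x, y) = 'D_v (fun x' => f (x', y)) x.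
Proof.
have E h : h *: (v, 0) + (x, y) = (h *: v + x, y) :> U * V.
  by congr (_, _); rewrite /= scaler0 add0r.
rewrite /derive; suff -> : (fun h => h^-1 *: ((f \o shift (x, y)) (h *: (v, 0)) - f (x, y))) =
  (fun h => h^-1 *: (((fun x' => f (x', y)) \o shift x) (h *: v) - f (x, y))) by [].
by apply/funext => h /=; rewrite E.
Qed.

Lemma differentiable_pair_cst (R : realType) (U V : normedModType R) (x : U) (y : V) :
  differentiable (fun x' : U => (x', y)) x.
Proof.
apply: (@differentiable_pair _ _ _ _ id (cst y)); last exact: differentiable_cst.
exact: (ex_diff (is_diff_def := is_diff_id x)).
Qed.

Lemma differentiable_rV (R : realType) (V : normedModType R) n
    (f : V -> 'rV[R]_n) (x : V) :
  (forall j, differentiable (fun x => f x 0 j) x) -> differentiable f x.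
Proof.
move=> fd; have -> : f = \sum_(j < n) (fun x => f x 0 j *: delta_mx 0 j).
  apply/funext => y; rewrite [LHS]row_sum_delta.
  by rewrite (big_morph (fun g : V -> 'rV[R]_n => g y) (id1 := 0) (op1 := +%R)).
by apply: differentiable_sum => j; exact: differentiableZl.
Qed.

(** * The Jacobian of the evaluation map *)

Section Jacobian.
Variables (R : realType) (m : nat).
Local Notation P := (params R m ones).
Local Notation X := 'cV[R]_1.
Implicit Types (theta v : P) (z : X) (Z : seq X).

Definition output z theta : R := realization (n := ones) theta z (0 : 'I_1) 0.

Lemma eval_map_output Z (q : 'I_(size Z * ones m)) :
  exists2 z, z \in Z & forall theta, eval_map (n := ones) Z theta 0 q = output z theta.
Proof.
case/mxvec_indexP: q => i j; exists Z`_i; first exact: mem_nth.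
by move=> theta; rewrite /eval_map mxvecE mxE /output; congr (_ _ _); rewrite ord1.
Qed.

Lemma output_eval_map Z z : z \in Z -> exists q : 'I_(size Z * ones m),
  forall theta, eval_map (n := ones) Z theta 0 q = output z theta.
Proof.
move=> zZ; have iz : (index z Z < size Z)%N by rewrite index_mem.
exists (mxvec_index (Ordinal iz) (0 : 'I_1)) => theta.
by rewrite /eval_map mxvecE mxE /output /= nth_index.
Qed.

Lemma output_differentiable theta z : param_smooth (n := ones) theta z ->
  differentiable (output z) theta.
Proof.
move=> [U [oU Up /(_ 1%N) [/(_ _ Up) df _]]].
have dr := differentiable_comp (differentiable_pair_cst _ z) df.
apply: (@differentiable_comp _ _ _ _ _ (fun M : 'M[R]_(1, 1) => M 0 0) _ dr).
exact: differentiable_coord.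
Qed.

Lemma output_derive theta z v : param_smooth (n := ones) theta z ->
  \forall theta' \near theta,
    'D_v (output z) theta' = 'D_(v, 0) (@evalF R m ones) (theta', z) (0 : 'I_1) 0.
Proof.
move=> [U [oU Up /(_ 1%N) [df _]]].
have := near_fst (open_nbhs_nbhs (conj oU Up)).
apply: filterS => theta' Up'; rewrite derive_fst derive_mx; first by rewrite mxE.
apply: diff_derivable.
exact: (differentiable_comp (differentiable_pair_cst _ z) (df _ Up')).
Qed.

(** The C^1 condition makes the joint derivative along [(v, 0)] continuous at [(theta, z)]; it is
    then restricted to the slice of fixed [z]. *)
Lemma output_derive_continuous theta z v : param_smooth (n := ones) theta z ->
  {for theta, continuous ('D_v (output z))}.
Proof.
move=> sm; have E := output_derive v sm.
case: sm => [U [oU Up /(_ 1%N) [_ /(_ (v, 0)) /(_ _ Up) cf]]].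
change ('D_v (output z) @ theta --> 'D_v (output z) theta).
rewrite (nbhs_singleton E).
pose D t := 'D_(v, 0) (@evalF R m ones) (t, z) : 'M[R]_(1, 1).
apply: (@cvg_trans _ ((fun t => D t 0 0) @ theta)).
  by apply: (@near_eq_cvg _ _ (nbhs theta)); apply: filterS E => t ->.
apply: (@cvg_comp _ _ _ D (fun M => M 0 0) _ (nbhs (D theta))).
  by move=> A /cf /near_fst.
exact: coord_continuous.
Qed.

(** Written through partial derivatives, so that semicontinuity of the rank applies entry by entry;
    where [Z] is parametrically smooth it is the transpose of ['J]. *)
Definition eval_grad Z theta : 'M[R]_(size Z * ones m, param_dim m ones) :=
  \matrix_(q, k) 'D_(delta_mx 0 k) (fun theta' => eval_map (n := ones) Z theta' 0 q) theta.

Lemma eval_map_differentiable Z theta : param_smooth_seq (n := ones) theta Z ->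
  differentiable (eval_map (n := ones) Z) theta.
Proof.
move=> sm; apply: differentiable_rV => q; have [z zZ E] := eval_map_output q.
by rewrite (funext E); exact/output_differentiable/sm.
Qed.

Lemma jacobian_eval_map Z theta : param_smooth_seq (n := ones) theta Z ->
  ('J (eval_map (n := ones) Z) theta)^T = eval_grad Z theta.
Proof.
move=> sm; have dE := eval_map_differentiable sm.
apply/matrixP => q k; rewrite [LHS]mxE [RHS]mxE.
have := deriveEjacobian (delta_mx 0 k) dE.
rewrite -rowE => /(congr1 (fun M : 'rV_ _ => M 0 q)); rewrite mxE => <-.
by rewrite derive_mx ?mxE//; exact: diff_derivable.
Qed.

Lemma eval_grad_continuous Z theta : param_smooth_seq (n := ones) theta Z ->
  forall q k, {for theta, continuous (fun theta' => eval_grad Z theta' q k)}.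
Proof.
move=> sm q k; have [z zZ E] := eval_map_output q.
have -> : (fun theta' => eval_grad Z theta' q k) = 'D_(delta_mx 0 k) (output z).
  by apply/funext => t; rewrite mxE (funext E).
exact/output_derive_continuous/sm.
Qed.

End Jacobian.


(** * Upper bound *)

Lemma eq_net (R : realType) (a b a' b' : nat -> R) x k :
  (forall i, (i < k)%N -> a i = a' i) -> (forall i, (i < k)%N -> b i = b' i) ->
  net a b x k = net a' b' x k.
Proof.
elim: k => //= k IH aE bE; rewrite aE// bE// IH// => i ik.
  exact/aE/ltnW.
exact/bE/ltnW.
Qed.

Lemma net_active (R : realType) (a b : nat -> R) x k :
  (0 < net a b x k.+1) = (0 < preact a b x k).
Proof. by rewrite /= lt_max ltxx. Qed.

Lemma net_dead (R : realType) (a b : nat -> R) x k :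
  ~~ (0 < preact a b x k) -> net a b x k.+1 = 0.
Proof. by rewrite -net_active -leNgt => h; apply/eqP; rewrite eq_le h net_ge0. Qed.

(** Only the finitely many values [- c] are excluded; the punctured neighbourhood takes care of
    [c = 0]. *)
Lemma near_dnbhs0_avoid (R : realType) (s : seq R) :
  \forall t \near 0^', all (fun c : R => t + c != 0) s.
Proof.
elim: s => [|c s IH] /=; first exact: filterE.
suff h : \forall t \near 0^', t + c != 0 by apply: filterS2 h IH => t -> ->.
have [->|c0] := eqVneq c 0.
  by apply: filterS (nbhs_dnbhs_neq (0 : R)) => t; rewrite addr0.
apply: nbhs_dnbhs; have : (nbhs (0 : R)) [set t | t != - c].
  by apply: open_nbhs_nbhs; split; [exact: open_neq|rewrite /= eq_sym oppr_eq0].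
by apply: filterS => t /=; rewrite addr_eq0.
Qed.

Section UpperBound.
Variables (R : realType) (m : nat).
Local Notation P := (params R m ones).
Local Notation X := 'cV[R]_1.
Implicit Types (theta v : P) (z : X) (Z : seq X).

(** The layers are treated in order. Adding [t] to the bias of layer [k] leaves the earlier
    preactivations alone and shifts that of layer [k] by exactly [t] at every point, so a small [t]
    avoids the finitely many bad values. Staying in the interior of [A] leaves room for the next
    layer. *)
Lemma regular_dense Z theta (A : set P) : nbhs theta A ->
  exists2 theta', A theta' & forall z, z \in Z -> regular (theta', z).
Proof.
move=> nA.
suff /(_ m (leqnn m)) [theta' /interior_subset At reg] : forall k, (k <= m)%N ->
    exists2 theta', A° theta' &
      forall z, z \in Z -> forall i, (i < k)%N -> preact_at i (theta', z) != 0.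
  by exists theta' => // z /reg h i im; exact: h.
elim=> [_|k IH km]; first by exists theta => //; exact: nbhs_singleton (nbhs_interior nA).
have [t1 At1 reg] := IH (ltnW km).
pose d : P := param_of m (fun=> 0) (fun i => (i == k)%:R).
have slopeE t : slope (t *: d + t1) = slope t1.
  apply/funext => i; rewrite /slope coef_lin coef_param_of eqxx.
  by case: ifP; rewrite mulr0 add0r.
have biasE t i : bias (t *: d + t1) i = (if i == k then t else 0) + bias t1 i.
  rewrite /bias coef_lin coef_param_of; congr (_ + _).
  have [->|_] := eqVneq i k; last by case: ifP; rewrite mulr0.
  by rewrite km mulr1.
have netE t z i : (i <= k)%N -> net (slope (t *: d + t1)) (bias (t *: d + t1)) (z 0 0) i =
    net (slope t1) (bias t1) (z 0 0) i.
  move=> ik; rewrite slopeE; apply: eq_net => // j ji.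
  by rewrite biasE ifN ?add0r// neq_ltn (leq_trans ji).
have preE t z i : (i <= k)%N -> preact_at i (t *: d + t1, z) =
    (if i == k then t else 0) + preact_at i (t1, z).
  by move=> ik; rewrite /preact_at /preact netE//= slopeE biasE addrCA.
have cA : (fun t => t *: d + t1) @ (0 : R) --> t1.
  suff : (fun t => t *: d + t1) @ (0 : R) --> 0 *: d + t1 by rewrite scale0r add0r.
  by apply: cvgD; [apply: cvgZr_tmp; exact: cvg_id|exact: cvg_cst].
have nA1 : \forall t \near 0^', A° (t *: d + t1).
  by apply: nbhs_dnbhs; apply: cA; apply: open_nbhs_nbhs; split=> //; exact: open_interior.
have [t [At av]] := filter_ex (filterI nA1 (near_dnbhs0_avoid [seq preact_at k (t1, z) | z <- Z])).
exists (t *: d + t1) => // z zZ i; rewrite ltnS leq_eqVlt => /predU1P[->|ik].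
  by rewrite preE// eqxx; apply: (allP av); exact: map_f.
by rewrite preE ?(ltnW ik)// ifN ?add0r ?reg// neq_ltn ik.
Qed.

(** The gradient, in the parameter coordinates, of the network with its pattern frozen. *)
Definition tangent_row theta pat x : 'rV[R]_(param_dim m ones) :=
  \row_k lin_tangent pat (slope theta) (bias theta)
    (slope (delta_mx 0 k : P)) (bias (delta_mx 0 k : P)) x m.

Lemma row_eval_grad Z theta q : (forall z, z \in Z -> regular (theta, z)) ->
  exists2 z, z \in Z & row q (eval_grad Z theta) = tangent_row theta (pat_at (theta, z)) (z 0 0).
Proof.
move=> reg; have [z zZ E] := eval_map_output q; exists z => //.
apply/rowP => k; rewrite !mxE (funext E) derive_realization//.
exact: reg.
Qed.

Lemma tangent_row_affine theta pat x : tangent_row theta pat x =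
  tangent_row theta pat 0 + x *: (tangent_row theta pat 1 - tangent_row theta pat 0).
Proof. by apply/rowP => k; rewrite !mxE lin_tangent_affine. Qed.

Definition last_dead theta (j : 'I_m) z :=
  ~~ pat_at (theta, z) j && [forall i : 'I_m, (j < i)%N ==> pat_at (theta, z) i].

(* The last layer is excluded: a point that is dead there has output 0 for all
   nearby parameters. *)
Definition plateaus theta Z : {set 'I_m} :=
  [set j : 'I_m | (j.+1 != m) && has (last_dead theta j) Z]%SET.

Lemma card_plateaus_depth theta Z : (#|plateaus theta Z| <= m.-1)%N.
Proof.
case: (posnP m) => [m0|m0].
  by rewrite (leq_trans (max_card _))// card_ord m0.
(* The last layer has index [m.-1], so [plateaus] sits in the complement of one element. *)
have lm : (m.-1 < m)%N by rewrite prednK.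
rewrite -[leqRHS](congr1 predn (card_ord m)) -(cardsC1 (Ordinal lm)).
apply/subset_leq_card/fintype.subsetP => j; rewrite !inE => /andP[jm _].
by apply: contraNneq jm => ->; rewrite /= prednK.
Qed.

Lemma card_plateaus theta Z : (#|plateaus theta Z| <= 2)%N.
Proof.
have deadP (j : 'I_m) : j \in plateaus theta Z -> exists2 x,
    net (slope theta) (bias theta) x j.+1 = 0 &
    forall i, (j < i < m)%N -> 0 < net (slope theta) (bias theta) x i.+1.
  rewrite inE => /andP[_ /hasP[z _ /andP[/net_dead dj /forallP act]]].
  exists (z 0 0) => // i /andP[ji im]; rewrite net_active.
  by have /implyP := act (Ordinal im); apply.
have no3 (j k l : 'I_m) : j \in plateaus theta Z -> k \in plateaus theta Z ->
    l \in plateaus theta Z -> (l < k < j)%N -> False.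
  move=> /deadP[x xj _] /deadP[y yk yp] /deadP[w wl wp] lkj.
  exact: (no_three_plateaus lkj (ltn_ord j) xj yk wl yp wp).
rewrite leqNgt; apply/negP => /card_gt2P[j [k [l [[jJ kJ lJ] [jk kl lj]]]]].
move: jk kl lj; rewrite -!val_eqE /= => jk kl lj.
have : [|| (l < k < j)%N, (k < l < j)%N, (l < j < k)%N,
    (j < l < k)%N, (j < k < l)%N | (k < j < l)%N] by lia.
by case/or4P => [||| /or3P[||]]; apply: no3.
Qed.

(** Every row is the gradient of a frozen network: fully active ones lie in the span of [T 0] and
    [T 1], the others equal [D j] for their last dead layer [j]. *)
Lemma rank_eval_grad_regular Z theta : (forall z, z \in Z -> regular (theta, z)) ->
  (\rank (eval_grad Z theta) <= 2 + #|plateaus theta Z|)%N.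
Proof.
move=> reg; pose T := tangent_row theta xpredT.
pose D (j : 'I_m) := tangent_row theta (fun i => j < i)%N 0.
pose S := (\sum_(j in plateaus theta Z) <<D j>>)%MS.
have rS : (\rank S <= #|plateaus theta Z|)%N.
  rewrite /S -sum1_card; elim/big_rec2: _ => [|j n A _ IH]; first by rewrite mxrank0.
  apply: leq_trans (mxrank_adds_leqif _ _) _.
  by apply: leq_add => //; rewrite genmxE rank_leq_row.
have rTT : (\rank (T 0%R + T 1%R)%MS <= 2)%N.
  apply: leq_trans (mxrank_adds_leqif _ _) _.
  by apply: (@leq_add _ _ 1 1); exact: rank_leq_row.
suff /mxrankS h : (eval_grad Z theta <= T 0%R + T 1%R + S)%MS.
  apply: leq_trans h _; apply: leq_trans (mxrank_adds_leqif _ _) _.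
  exact: leq_add.
apply/row_subP => q; have [z zZ ->] := row_eval_grad q reg.
case: (last_deadP (pat_at (theta, z)) m) => [act|[j jm [dj act]]].
  have -> : tangent_row theta (pat_at (theta, z)) (z 0 0) = T (z 0 0).
    by apply/rowP => k; rewrite !mxE; apply: eq_lin_tangent.
  apply: submx_trans (addsmxSl _ _); rewrite /T tangent_row_affine.
  rewrite addmx_sub ?addsmxSl// scalemx_sub// addmx_sub ?addsmxSr//.
  by rewrite -scaleN1r scalemx_sub// addsmxSl.
have -> : tangent_row theta (pat_at (theta, z)) (z 0 0) = D (Ordinal jm).
  by apply/rowP => k; rewrite !mxE; exact: lin_tangent_last_dead.
(* If the last layer is dead, the output is locally 0 and the row vanishes. *)
have [jl|jl] := eqVneq j.+1 m.
  suff -> : D (Ordinal jm) = 0 by exact: sub0mx.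
  apply/rowP => k; rewrite !mxE /=.
  by rewrite -[X in lin_tangent _ _ _ _ _ _ X]jl /= ltnn.
apply: submx_trans (addsmxSr _ _); rewrite -genmxE.
apply: (sumsmx_sup (Ordinal jm)) => //.
rewrite inE /= jl; apply/hasP; exists z => //; rewrite /last_dead dj /=.
by apply/forallP => i; apply/implyP => ji; apply: act; rewrite ji ltn_ord.
Qed.

(** Some nearby parameter is regular at all of [Z] and has at least the same rank; there 2 plus the
    number of plateaus bounds it, and that number is at most both m - 1 and 2. *)
Lemma rank_jacobian_le Z theta : (0 < m)%N -> param_smooth_seq (n := ones) theta Z ->
  (\rank ('J (eval_map (n := ones) Z) theta)^T <= minn m.+1 4)%N.
Proof.
move=> m0 sm; rewrite jacobian_eval_map//.
have [t le reg] := regular_dense Z (mxrank_lower_semicontinuous (eval_grad_continuous sm)).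
apply: leq_trans le _; apply: leq_trans (rank_eval_grad_regular reg) _.
have := card_plateaus t Z; have := card_plateaus_depth t Z.
by rewrite leq_min; lia.
Qed.

End UpperBound.


(** * Lower bound *)

Section Tangent.
Variables (R : realType) (pat : nat -> bool) (a b da db : nat -> R) (x : R).
Variables (j k : nat).
Hypotheses (jk : (j <= k)%N) (da0 : forall i, (j <= i)%N -> da i = 0)
  (db0 : forall i, (j <= i)%N -> db i = 0).

(** The perturbation acts only before layer [j]; later layers merely scale the tangent by their
    slope or reset it to 0. *)
Lemma lin_tangent_eq0 :
  lin_tangent pat a b da db x j = 0 -> lin_tangent pat a b da db x k = 0.
Proof.
move=> t0; rewrite -(subnK jk); elim: (k - j)%N => // i IH.
by rewrite addSn /= IH da0 ?db0 ?leq_addl// mul0r mulr0 !addr0 if_same.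
Qed.

Lemma lin_tangent_neq0 :
  (forall i, (j <= i < k)%N -> pat i) -> (forall i, (j <= i < k)%N -> a i != 0) ->
  lin_tangent pat a b da db x j != 0 -> lin_tangent pat a b da db x k != 0.
Proof.
move=> act an0 t0; suff h i : (j + i <= k)%N -> lin_tangent pat a b da db x (j + i) != 0.
  by rewrite -(subnKC jk) h// subnKC.
elim: i => [|i IH]; rewrite ?addn0// addnS => ik.
have ji : (j <= j + i < k)%N by rewrite leq_addr.
rewrite /= act// da0 ?db0 ?leq_addr// mul0r add0r addr0.
by rewrite mulf_neq0 ?an0 ?IH// ltnW.
Qed.

End Tangent.

Section LowerBound.
Variables (R : realType) (m : nat).
Local Notation P := (params R m ones).
Local Notation X := 'cV[R]_1.
Hypothesis m0 : (0 < m)%N.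

(** Layer 0 is dead for x < 0 and layer 1 for x > 3, which gives the two plateaus; the bias 1 of
    layer 2 keeps all preactivations from there on positive. *)
Definition wit_slope (i : nat) : R := if i == 1%N then -1 else 1.
Definition wit_bias (i : nat) : R := if i == 1%N then 3 else (i == 2)%:R.
Definition wit : P := param_of m wit_slope wit_bias.

Lemma slope_wit i : (i < m)%N -> slope wit i = wit_slope i.
Proof. by rewrite /slope coef_param_of eqxx => ->. Qed.

Lemma bias_wit i : (i < m)%N -> bias wit i = wit_bias i.
Proof. by rewrite /bias coef_param_of => ->. Qed.

Lemma preact_wit (z : X) i : (i < m)%N ->
  preact_at i (wit, z) = preact wit_slope wit_bias (z 0 0) i.
Proof.
move=> im; rewrite /preact_at /preact /= slope_wit// bias_wit//.
congr (_ * _ + _); apply: eq_net => k ki; have km := ltn_trans ki im.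
  exact: slope_wit.
exact: bias_wit.
Qed.

Lemma preact_wit0 x : preact wit_slope wit_bias x 0 = x.
Proof. by rewrite /preact /= mul1r addr0. Qed.

Lemma preact_wit1 x : preact wit_slope wit_bias x 1 = 3 - Num.max 0 x.
Proof. by rewrite /preact /= mulN1r addrC /wit_slope /wit_bias /= mul1r addr0. Qed.

Lemma preact_wit_gt0 x i : (1 < i)%N -> 0 < preact wit_slope wit_bias x i.
Proof.
elim: i => // i IH; rewrite ltnS leq_eqVlt => /predU1P[<-|/[dup] i1 /IH].
  by rewrite /preact mul1r; apply: ltr_wpDl => //; exact: net_ge0.
rewrite -net_active /preact => h.
by rewrite /wit_slope /wit_bias !eqSS !gtn_eqF ?(ltnW i1)// mul1r addr0.
Qed.

Lemma regular_wit (z : X) : z 0 0 != 0 -> z 0 0 != 3 -> regular (wit, z).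
Proof.
move=> z0 z3 i im; rewrite preact_wit//; case: i im => [|[|i]] im.
- by rewrite preact_wit0.
- rewrite preact_wit1 subr_eq0; case: (leP 0 (z 0 0)) => _; first by rewrite eq_sym.
  by rewrite pnatr_eq0.
- by rewrite gt_eqF// preact_wit_gt0.
Qed.

(* The first direction is chosen so that the derivative at the second point of
   [pts] vanishes, which makes the matrix [wit_tangent] triangular. *)
Definition dir (k : nat) : P := param_of m (fun i => ((k == 0) && (i == 0))%N%:R)
  (fun i => if k is k'.+1 then (i == k')%:R else - (i == 0)%N%:R).

Lemma slope_dir k i : slope (dir k) i = ((k == 0) && (i == 0))%N%:R.
Proof.
rewrite /slope coef_param_of eqxx; case: ltnP => // mi.
by rewrite [i == 0]gtn_eqF ?andbF// (leq_trans m0).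
Qed.

Lemma bias_dir k i : (k <= m)%N ->
  bias (dir k) i = if k is k'.+1 then (i == k')%:R else - (i == 0)%N%:R.
Proof.
move=> km; rewrite /bias coef_param_of; case: ltnP => // mi.
case: k km => [|k] km; rewrite gtn_eqF ?oppr0//; exact: leq_trans mi.
Qed.

(** All layers are active at 2 and 1; the last dead layer is 0 at -1 and 1 at 4. The triangular
    matrix for depth m uses the first min (m + 1, 4) points. *)
Definition pts : seq R := [:: 2; 1; -1; 4].

Definition wit_tangent i k : R :=
  lin_tangent (pat_at (wit, const_mx pts`_i : X)) (slope wit) (bias wit)
    (slope (dir k)) (bias (dir k)) pts`_i m.

Lemma pat_wit x i : (i < m)%N -> pat_at (wit, const_mx x : X) i =
  if i == 0%N then 0 < x else if i == 1%N then x < 3 else true.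
Proof.
move=> im; rewrite /pat_at preact_wit// mxE; case: i im => [|[|i]] im /=.
- by rewrite preact_wit0.
- by rewrite preact_wit1 subr_gt0 gt_max ltr0n.
- exact: preact_wit_gt0.
Qed.

(** Direction 0 changes layer 0 by x - 1, which vanishes at x = 1. At -1 and 4 the directions
    concerned touch only layers up to the dead one, which erases their effect. *)
Lemma wit_tangent_lower i k : (k < i < 4)%N -> (i <= m)%N -> wit_tangent i k = 0.
Proof.
move=> /andP[ki i4] im; have km : (k <= m)%N by rewrite ltnW// (leq_trans ki).
have da0 j : (k <= j)%N -> (0 < j)%N -> slope (dir k) j = 0.
  by move=> kj j0; rewrite slope_dir [j == 0]gtn_eqF// andbF.
have db0 j : (k <= j)%N -> (0 < j)%N -> bias (dir k) j = 0.
  move=> kj j0; rewrite bias_dir//; case: k kj {ki km da0} => [|k] kj.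
    by rewrite gtn_eqF// oppr0.
  by rewrite gtn_eqF.
case: i ki i4 im => [//|[|[|[|//]]]] ki _ im.
- apply: (@lin_tangent_eq0 _ _ _ _ _ _ _ 1) => //.
  + by move=> j j1; rewrite da0// (leq_trans _ j1)// ltnW.
  + by move=> j j1; rewrite db0// (leq_trans _ j1)// ltnW.
  + have -> : k = 0%N by lia.
    rewrite /= pat_wit//= ltr01 slope_dir bias_dir//= mulr1 mulr0 addr0.
    by rewrite subrr.
- apply: (@lin_tangent_eq0 _ _ _ _ _ _ _ 1) => //.
  + by move=> j j1; rewrite da0// (leq_trans _ j1).
  + by move=> j j1; rewrite db0// (leq_trans _ j1).
  + by rewrite /= pat_wit//= oppr_gt0 ltr10.
- apply: (@lin_tangent_eq0 _ _ _ _ _ _ _ 2); first exact: ltnW.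
  + by move=> j j1; rewrite da0 ?(leq_trans _ j1).
  + by move=> j j1; rewrite db0 ?(leq_trans _ j1).
  + by rewrite /= (pat_wit _ (ltnW im : (1 < m)%N)) /= ltr_nat.
Qed.

(** The perturbed layer and all later ones are active at the point, with nonzero slopes; for
    direction 0 the factor x - 1 is 1 at x = 2. *)
Lemma wit_tangent_diag i : (i < 4)%N -> (i <= m)%N -> wit_tangent i i != 0.
Proof.
move=> i4 im.
have da0 j : (0 < j)%N -> slope (dir i) j = 0.
  by move=> j0; rewrite slope_dir [j == 0]gtn_eqF// andbF.
have db0 j : (i <= j)%N -> (0 < j)%N -> bias (dir i) j = 0.
  move=> kj j0; rewrite bias_dir//; case: i kj {i4 im da0} => [|k] kj.
    by rewrite gtn_eqF// oppr0.
  by rewrite gtn_eqF.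
have an0 j : (j < m)%N -> slope wit j != 0.
  by move=> jm; rewrite slope_wit// /wit_slope; case: ifP; rewrite ?oppr_eq0 oner_eq0.
case: i i4 im da0 db0 => [|[|[|[|//]]]] _ im da0 db0.
- apply: (@lin_tangent_neq0 _ _ _ _ _ _ _ 1) => //; last 1 first.
  + rewrite /= pat_wit//= ltr0n slope_dir bias_dir//= mulr0 addr0 mul1r.
    by rewrite gt_eqF// subr_gt0 ltr_nat.
  + by move=> j j1; exact: db0.
  + move=> j /andP[j1 jm]; rewrite pat_wit// gtn_eqF//=.
    by case: ifP => // _; rewrite ltr_nat.
  + by move=> j /andP[_ /an0].
- apply: (@lin_tangent_neq0 _ _ _ _ _ _ _ 1) => //; last 1 first.
  + rewrite /= pat_wit//= ltr01 slope_dir bias_dir//= mulr0 mul0r !add0r.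
    exact: oner_neq0.
  + by move=> j j1; exact: db0.
  + move=> j /andP[j1 jm]; rewrite pat_wit// gtn_eqF//=.
    by case: ifP => // _; rewrite ltr1n.
  + by move=> j /andP[_ /an0].
- apply: (@lin_tangent_neq0 _ _ _ _ _ _ _ 2) => //; last 1 first.
  + rewrite /= (pat_wit _ m0) (pat_wit _ im) /= oppr_gt0 ltr10.
    rewrite (lt_trans (ltrN10 _)) ?ltr0n// slope_dir bias_dir//= !mulr0 ?mul0r !add0r.
    exact: oner_neq0.
  + by move=> j j1; rewrite da0// (leq_trans _ j1).
  + by move=> j j1; rewrite db0// (leq_trans _ j1).
  + by move=> j /andP[j1 jm]; rewrite pat_wit// !gtn_eqF// (leq_trans _ j1).
  + by move=> j /andP[_ /an0].
- apply: (@lin_tangent_neq0 _ _ _ _ _ _ _ 3) => //; last 1 first.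
  + rewrite /= (pat_wit _ im) (pat_wit _ (ltnW im : (1 < m)%N)) /= ltr_nat /=.
    rewrite slope_dir bias_dir//= !mulr0 ?mul0r !add0r.
    exact: oner_neq0.
  + by move=> j j1; rewrite da0// (leq_trans _ j1).
  + by move=> j j1; rewrite db0// (leq_trans _ j1).
  + move=> j /andP[j1 jm]; rewrite pat_wit// !gtn_eqF// (leq_trans _ j1)//.
  + by move=> j /andP[_ /an0].
Qed.

Definition wit_points : seq X := [seq const_mx x | x <- pts].

Lemma uniq_wit_points : uniq wit_points.
Proof.
rewrite map_inj_uniq; last by move=> x y /matrixP/(_ 0 0); rewrite !mxE.
rewrite /= !inE !negb_or; do !(apply/andP; split) => //; apply/eqP; lra.
Qed.

Lemma regular_wit_points z : z \in wit_points -> regular (wit, z).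
Proof.
case/mapP => x xs ->; apply: regular_wit; rewrite mxE;
  move: xs; rewrite !inE => /or4P[] /eqP ->; apply/eqP; lra.
Qed.

Lemma smooth_wit_points : param_smooth_seq (n := ones) wit wit_points.
Proof. by move=> z /regular_wit_points/regular_smooth. Qed.

Lemma eval_grad_mul Z (theta v : P) q : param_smooth_seq (n := ones) theta Z ->
  (eval_grad Z theta *m v^T) q 0 =
  'D_v (fun theta' => eval_map (n := ones) Z theta' 0 q) theta.
Proof.
move=> sm; have dE := eval_map_differentiable sm.
rewrite -jacobian_eval_map// -trmx_mul mxE -deriveEjacobian//.
by rewrite derive_mx ?mxE//; exact: diff_derivable.
Qed.

Lemma rank_wit : (minn m.+1 4 <= \rank ('J (eval_map (n := ones) wit_points) wit)^T)%N.
Proof.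
set r := minn m.+1 4; rewrite jacobian_eval_map; last exact: smooth_wit_points.
have ir (i : 'I_r) : (i <= m)%N /\ (i < 4)%N.
  by have := ltn_ord i; rewrite leq_min ltnS => /andP.
have ip (i : 'I_r) : const_mx pts`_i \in wit_points.
  by rewrite map_f// mem_nth//; case: (ir i).
have [q qE] := choice (fun i : 'I_r => output_eval_map m (ip i)).
pose V : 'M[R]_(r, param_dim m ones) := \matrix_k dir k.
(* Entry i, k is the derivative of the output at point i along [dir k]; selecting rows and
   multiplying by [V^T] cannot raise the rank. *)
pose M := rowsub q (eval_grad wit_points wit *m V^T).
have ME i k : M i k = wit_tangent i k.
  transitivity ((eval_grad wit_points wit *m (dir k)^T) (q i) 0).
    by rewrite !mxE; apply: eq_bigr => c _; rewrite !mxE.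
  rewrite eval_grad_mul; last exact: smooth_wit_points.
  rewrite (funext (qE i)) derive_realization ?mxE//.
  exact/regular_wit_points/ip.
have Mu : M \in unitmx.
  (* [det_trig] wants zeros above the diagonal, while [M] has them below, hence the transpose. *)
  rewrite -unitmx_tr unitmxE unitfE det_trig.
    apply/prodf_neq0 => i _; rewrite mxE ME; have [im i4] := ir i.
    exact: wit_tangent_diag.
  apply/is_trig_mxP => k i ki; rewrite mxE ME; have [im i4] := ir i.
  by rewrite wit_tangent_lower// ki.
rewrite -(mxrank_unit Mu) /M rowsubE.
exact: leq_trans (mxrankM_maxr _ _) (mxrankM_maxl _ _).
Qed.

End LowerBound.

(** * The functional dimension for architectures of ones *)

Lemma dim_fun_ones (R : realType) m : (0 < m)%N ->
  dim_fun_params R m ones = (minn m.+1 4)%:R%:E.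
Proof.
move=> m0; apply/eqP; rewrite eq_le; apply/andP; split.
  apply: ge_ereal_sup => _ [theta _ <-]; apply: ge_ereal_sup => _ [Z [_ sm] <-].
  by rewrite lee_fin ler_nat rank_jacobian_le.
apply: (@le_trans _ _ (dim_fun (n := ones) (wit R m))).
  apply: (@le_trans _ _ (\rank ('J (eval_map (n := ones) (wit_points R)) (wit R m))^T)%:R%:E).
    by rewrite lee_fin ler_nat rank_wit.
  apply: ereal_sup_ubound; exists (wit_points R) => //.
  by split; [exact: uniq_wit_points|exact: smooth_wit_points].
apply: ereal_sup_ubound; exists (wit R m) => //; exists (const_mx 1).
by apply: smooth_wit_points => //; rewrite map_f// !inE eqxx orbT.
Qed.

(** Hence the bound agrees with min (m + 1, 4) exactly when m <= 3. *)
Lemma dim_fun_bound_ones m : dim_fun_bound m ones = m.+1.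
Proof. by rewrite /dim_fun_bound /ones sum_nat_const card_ord !muln1 add1n. Qed.

Theorem theorem9p1 (R : realType) :
  [/\ tight R 1 ones, tight R 2 ones & tight R 3 ones] /\
  (forall m : nat, (4 <= m)%N ->
     ~ tight R m ones /\ dim_fun_params R m ones = 4%:R%:E).
Proof.
rewrite /tight !dim_fun_bound_ones !dim_fun_ones//; split=> // m m4.
have m0 : (0 < m)%N by rewrite (leq_trans _ m4).
have mE : minn m.+1 4 = 4 by rewrite (minn_idPr _)// ltnW.
rewrite dim_fun_bound_ones dim_fun_ones// mE; split=> //.
move=> [] /eqP; rewrite eqr_nat => /eqP e.
by move: m4; rewrite -ltnS -e ltnn.
Qed.
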